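(* Let $A,B,C\in\mathbb{C}^{n\times n}$ satisfy $ABA=ACA$. If $s\geq \max\{\mathrm{ind}(AC),\mathrm{ind}(BA)\}$, where $s$ is an integer, then $(AC)^s\sim (BA)^s$.
   Context: For a square complex matrix $X$, its Drazin inverse $X^D$ is the unique matrix $Y$ with $XY=YX$, $YXY=Y$ and $X^{k+1}Y=X^k$ for some nonnegative integer $k$ (it always exists); the least such nonnegative integer $k$ is the index of $X$, denoted $\mathrm{ind}(X)$. For $X,Y\in\mathbb{C}^{n\times n}$, $X\sim Y$ means that $X=S^{-1}YS$ for some invertible $S\in\mathbb{C}^{n\times n}$. *)

(* Defs.v *)
From mathcomp Require Import all_boot all_order all_algebra.
From mathcomp Require Import boolp ring.

Set Implicit Arguments.
Unset Strict Implicit.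
Unset Printing Implicit Defensive.

Import GRing.Theory.
Local Open Scope ring_scope.

(* Powers X ^+ k are taken in the ring 'M[F]_n, so that X ^+ 0 = 1%:M. *)
Definition is_drazin_inverse (F : fieldType) (n : nat) (X Y : 'M[F]_n) : Prop :=
  [/\ X *m Y = Y *m X, Y *m X *m Y = Y &
      exists k : nat, X ^+ k.+1 *m Y = X ^+ k].

Lemma drazin_ring_inj (R : pzRingType) (x y z : R) (k l : nat) :
    x * y = y * x -> y * x * y = y -> x ^+ k.+1 * y = x ^+ k ->
    x * z = z * x -> z * x * z = z -> x ^+ l.+1 * z = x ^+ l ->
  y = z.
Proof.
move=> cy iy hy cz iz hz.
have up (w : R) j m : x ^+ j.+1 * w = x ^+ j ->
    x ^+ (m + j).+1 * w = x ^+ (m + j).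
  by move=> h; rewrite -addnS !exprD -mulrA h.
have {}hy := up y k l hy.
have {hz} := up z l k hz; rewrite addnC.
move: hy; set m := (l + k)%N => hy hz.
have yE j : y = y ^+ j.+1 * x ^+ j.
  elim: j => [|j IH]; first by rewrite expr1 mulr1.
  have c : GRing.comm (y ^+ j.+1) x by apply/commr_sym/commrX.
  by rewrite [y ^+ j.+2]exprS [x ^+ j.+1]exprSr mulrA -(mulrA y) -IH -mulrA -cy mulrA iy.
have zE j : z = x ^+ j * z ^+ j.+1.
  elim: j => [|j IH]; first by rewrite mul1r.
  by rewrite [z ^+ j.+2]exprSr [x ^+ j.+1]exprS -mulrA (mulrA _ _ z) -IH mulrA cz iz.
have hy' : y * x ^+ m.+1 = x ^+ m.
  have c : GRing.comm y (x ^+ m.+1) by apply/commrX/commr_sym.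
  by rewrite c hy.
have yxz : y = y * x * z.
  by rewrite [LHS](yE m) -hz [x ^+ m.+1]exprSr !mulrA -(yE m).
by rewrite yxz [in RHS](zE m) -hy' [x ^+ m.+1]exprS -!mulrA -(zE m).
Qed.

Lemma is_drazin_inverse_inj (F : fieldType) (n : nat) (X Y Z : 'M[F]_n) :
  is_drazin_inverse X Y -> is_drazin_inverse X Z -> Y = Z.
Proof.
move=> [cY iY [k hY]] [cZ iZ [l hZ]].
exact: (drazin_ring_inj cY iY hY cZ iZ hZ).
Qed.

Lemma drazin_ring_exists (R : pzRingType) (x h : R) (k : nat) :
    x * h = h * x -> x ^+ k = x ^+ k.+1 * h ->
  let y := x ^+ k * h ^+ k.+1 in
  [/\ x * y = y * x, y * x * y = y & x ^+ k.+1 * y = x ^+ k].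
Proof.
move=> cxh hk y.
have chx i : GRing.comm (h ^+ i) x by apply/commr_sym/commrX.
have hki i : x ^+ k = x ^+ (k + i) * h ^+ i.
  elim: i => [|i IH]; first by rewrite addn0 mulr1.
  rewrite {1}IH addnC exprD hk mulrA -exprD -mulrA -exprS.
  by rewrite addnS addnC -addnS.
have cxy : x * y = y * x.
  by rewrite /y mulrA -exprS exprSr -!mulrA chx.
have xky : x ^+ k.+1 * y = x ^+ k.
  by rewrite /y mulrA -exprD [RHS](hki k.+1) addnC.
have cyx : GRing.comm y (x ^+ k.+1) by apply/commrX/commr_sym.
by split=> //; rewrite {2}/y mulrA -(mulrA y) -exprS cyx xky.
Qed.

Lemma drazin_inverse_exists (F : fieldType) (n : nat) (X : 'M[F]_n) :
  exists Y : 'M[F]_n, is_drazin_inverse X Y.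
Proof.
case: n X => [|n] X.
  by exists 0; split; [| |exists 0%N]; apply/matrixP => -[].
have [k [r hk]] : exists (k : nat) (r : {poly F}),
    horner_mx X ('X ^+ k) = horner_mx X ('X ^+ k.+1 * r).
  have [k [q /implyP q0 pE]] := multiplicity_XsubC (char_poly X) 0.
  have {}q0 : q.[0] != 0.
    by apply: q0; rewrite monic_neq0 ?char_poly_monic.
  exists k; rewrite subr0 in pE.
  have /factor_theorem[s] : root (q - q.[0]%:P) 0.
    by rewrite rootE !hornerE subrr.
  rewrite subr0 => /(canRL (subrK _)); set c := q.[0] in q0 * => qE.
  exists (- (c^-1 *: s)); apply/eqP; rewrite -subr_eq0 -rmorphB; apply/eqP.
  have -> : 'X ^+ k - 'X ^+ k.+1 * - (c^-1 *: s) = c^-1 *: char_poly X.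
    have e : (c^-1)%:P * c%:P = 1 by rewrite -polyCM mulVf.
    by rewrite pE qE -!mul_polyC exprS -[X in X - _ = _]mulr1 -e; ring.
  by rewrite -mul_polyC rmorphM /= Cayley_Hamilton mulr0.
have cXr : X * horner_mx X r = horner_mx X r * X.
  by rewrite -{1 4}(horner_mx_X X) -!rmorphM mulrC.
rewrite rmorphM !rmorphXn /= horner_mx_X in hk.
have [cY iY hY] := drazin_ring_exists cXr hk.
by eexists; split; [exact: cY | exact: iY | exists k; exact: hY].
Qed.

Definition drazin_inverse (F : fieldType) (n : nat) (X : 'M[F]_n) : 'M[F]_n :=
  projT1 (cid (drazin_inverse_exists X)).

Lemma drazin_inverseP (F : fieldType) (n : nat) (X : 'M[F]_n) :
  is_drazin_inverse X (drazin_inverse X).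
Proof. exact: projT2 (cid (drazin_inverse_exists X)). Qed.

Lemma drazin_index_exists (F : fieldType) (n : nat) (X : 'M[F]_n) :
  exists k : nat, X ^+ k.+1 *m drazin_inverse X == X ^+ k.
Proof. by case: (drazin_inverseP X) => _ _ [k /eqP]; exists k. Qed.

Definition drazin_index (F : fieldType) (n : nat) (X : 'M[F]_n) : nat :=
  ex_minn (drazin_index_exists X).

Definition mx_similar (F : fieldType) (n : nat) (X Y : 'M[F]_n) : Prop :=
  exists2 S : 'M[F]_n, S \in unitmx & X = invmx S *m Y *m S.

Lemma mx_similarP (F : fieldType) (n : nat) (X Y : 'M[F]_n) :
  mx_similar X Y <-> similar_in unitmx X Y.
Proof.
split=> -[S Su].
  by move=> XE; exists S => //; apply/(similarP Su); rewrite XE !mulmxA mulmxV ?mul1mx.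
by move/(similarP Su) => XE; exists S; rewrite // -mulmxA -XE mulKmx.
Qed.

(* Main.v *)
Require Import Defs.
From mathcomp Require Import all_boot all_order all_algebra.
From mathcomp Require Import reals complex.

Local Open Scope ring_scope.

(* Put M = AC and N = BA, with spectral idempotents P = M M^D and Q = N N^D.
   From ABA = ACA we get MA = AN and M^(k+1) = A N^k C, so A restricts to an
   isomorphism from the image of Q onto the image of P that intertwines N and M.
   Hence P and Q have the same rank, so 1 - P = u (1 - Q) v with u, v invertible,
   and S = A Q + u (1 - Q) is an invertible matrix with M^s S = S N^s as soon as
   M^s P = M^s and N^s Q = N^s. *)

Import GRing.Theory.

(** Rewrites the idempotent [x * y] with an arbitrarily high power of [x] in front; [x * y] absorbs
    the innermost pair at each step. *)
Lemma drazin_projX (R : pzRingType) (x y : R) (k : nat) :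
  x * y = y * x -> y * x * y = y -> x ^+ k.+1 * y ^+ k.+1 = x * y.
Proof.
move=> cxy yxy; elim: k => [|k IH]; first by rewrite !expr1.
have xyy : x * y * y = y by rewrite cxy yxy.
by rewrite [x ^+ _]exprS [y ^+ _]exprSr mulrA -(mulrA x) IH -mulrA xyy.
Qed.

Lemma intertwineX (R : pzRingType) (x y a : R) (k : nat) :
  x * a = a * y -> x ^+ k * a = a * y ^+ k.
Proof.
move=> xa; elim: k => [|k IH]; first by rewrite mul1r mulr1.
by rewrite exprSr -mulrA xa mulrA IH -mulrA -exprSr.
Qed.

Lemma drazin_index_leP (F : fieldType) (n : nat) (X : 'M[F]_n) (s : nat) :
  (drazin_index X <= s)%N -> X ^+ s.+1 * drazin_inverse X = X ^+ s.
Proof.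
rewrite /drazin_index; case: ex_minnP => k /eqP XkD _ /subnK <-.
by rewrite -addnS !exprD -mulrA; congr (_ * _).
Qed.

(** The row space of [1 - P] is the left kernel of [P]. *)
Lemma mxrank_idem_compl (F : fieldType) (n : nat) (P : 'M[F]_n) :
  P *m P = P -> \rank (1%:M - P) = (n - \rank P)%N.
Proof.
move=> PP; rewrite -mxrank_ker; apply: eqmx_rank; apply/andP; split.
  by apply/sub_kermxP; rewrite mulmxBl mul1mx PP subrr.
apply/submxP; exists (kermx P).
by rewrite mulmxBr mulmx1 mulmx_ker subr0.
Qed.

(** Both matrices have the same rank normal form, so [u] and [v] are quotients of their basis
    changes. *)
Lemma eq_mxrank_equiv (F : fieldType) (m n : nat) (X Y : 'M[F]_(m, n)) :
  \rank X = \rank Y ->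
  exists2 u : 'M[F]_m, u \in unitmx &
    exists2 v : 'M[F]_n, v \in unitmx & X = u *m Y *m v.
Proof.
move=> rXY; exists (col_ebase X *m invmx (col_ebase Y)).
  by rewrite unitmx_mul unitmx_inv !col_ebase_unit.
exists (invmx (row_ebase Y) *m row_ebase X).
  by rewrite unitmx_mul unitmx_inv !row_ebase_unit.
rewrite -{1}(mulmx_ebase X) -{2}(mulmx_ebase Y) rXY !mulmxA.
by rewrite mulmxKV ?col_ebase_unit // mulmxK ?row_ebase_unit.
Qed.

Lemma mx_similar_drazinX (F : fieldType) (n : nat) (A B C : 'M[F]_n) (s : nat) :
    A *m B *m A = A *m C *m A ->
    (drazin_index (A *m C) <= s)%N -> (drazin_index (B *m A) <= s)%N ->
  mx_similar ((A *m C) ^+ s) ((B *m A) ^+ s).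
Proof.
rewrite -![_ *m _]/(_ * _).
move=> ABA /drazin_index_leP + /drazin_index_leP.
have [] := drazin_inverseP (A * C); have [] := drazin_inverseP (B * A).
move: (drazin_inverse _) (drazin_inverse _) => D E cNE ENE _ cMD DMD _.
have MA : A * C * A = A * (B * A) by rewrite mulrA ABA.
(* Opaque names keep the products from unfolding during rewriting. *)
have [M defM] : {M | M = A * C} by exists (A * C).
have [N defN] : {N | N = B * A} by exists (B * A).
rewrite -defM -defN in cNE ENE cMD DMD MA * => MD NE.
have {}cMD : M * D = D * M := cMD; have {}DMD : D * M * D = D := DMD.
have {}cNE : N * E = E * N := cNE; have {}ENE : E * N * E = E := ENE.
have [P defP] : {P | P = M * D} by exists (M * D).
have [Q defQ] : {Q | Q = N * E} by exists (N * E).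
have PP : P * P = P by rewrite defP -mulrA (mulrA D) DMD.
have QQ : Q * Q = Q by rewrite defQ -mulrA (mulrA E) ENE.
have MsP : M ^+ s * P = M ^+ s by rewrite defP mulrA -exprSr.
have NsQ : N ^+ s * Q = N ^+ s by rewrite defQ mulrA -exprSr.
have cPM : GRing.comm P (M ^+ s).
  by apply: commrX; rewrite /GRing.comm defP -mulrA -cMD.
have cQN : GRing.comm Q (N ^+ s).
  by apply: commrX; rewrite /GRing.comm defQ -mulrA -cNE.
(* [A] maps the image of [Q] into that of [P]: [A * N ^+ s.+1] equals [M ^+ s.+1 * A], which [P]
   fixes on the left. *)
have PAQ : P * A * Q = A * Q.
  have QE : Q = N ^+ s.+1 * E ^+ s.+1 by rewrite defQ drazin_projX.
  have PMs : P * M ^+ s.+1 = M ^+ s.+1 by rewrite exprSr mulrA cPM MsP.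
  rewrite QE !mulrA -(mulrA P) -(intertwineX _ _ _ _ s.+1 MA).
  by rewrite (mulrA P) PMs.
(* [E * B] is a left inverse of [A] on the image of [Q]. *)
have EBAQ : E * B * A * Q = Q by rewrite -(mulrA E) -defN -cNE -defQ QQ.
have rPQ : \rank P = \rank Q.
  apply/eqP; rewrite eqn_leq; apply/andP; split.
    (* From [M ^+ s.+2 = A * N ^+ s.+1 * C], where [Q] fixes [N ^+ s]. *)
    have -> : P = A * Q * (N ^+ s * N * C * D ^+ s.+2).
      rewrite defP -(drazin_projX _ _ _ s.+1 cMD DMD) [M ^+ _]exprSr {2}defM (mulrA _ A).
      rewrite (intertwineX _ _ _ _ s.+1 MA) [N ^+ s.+1]exprSr !mulrA.
      by rewrite -(mulrA A Q) cQN NsQ.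
    by apply: leq_trans (mxrankM_maxl _ _) (mxrankM_maxr _ _).
  (* Conversely, [Q] factors through [P] as [E * B * P * A * Q]. *)
  rewrite -{1}EBAQ -(mulrA (E * B)) -PAQ mulrA mulrA.
  rewrite -(mulrA (E * B * P)).
  by apply: leq_trans (mxrankM_maxl _ _) (mxrankM_maxr _ _).
have [|u uU [v vU uv]] := @eq_mxrank_equiv F n n (1 - P) (1 - Q).
  by rewrite !mxrank_idem_compl // rPQ.
(* After multiplying by the invertible [v], this is [P * (1 - P) = 0]. *)
have Pu : P * u * (1 - Q) = 0.
  apply: (can_inj (mulmxK vU)); rewrite mul0mx.
  rewrite -(mulrA P) -[LHS]mulmxA -uv.
  by rewrite -[LHS]/(P * (1 - P)) mulrBr mulr1 PP subrr.
have P'AQ : (1 - P) * A * Q = 0 by rewrite !mulrBl mul1r PAQ subrr.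
have P'u : (1 - P) * u * (1 - Q) = u * (1 - Q).
  by rewrite mulrBl mul1r mulrBl Pu subr0.
have Q'Q' : (1 - Q) * (1 - Q) = 1 - Q.
  by rewrite mulrBr mulr1 mulrBl mul1r QQ subrr subr0.
pose S := A * Q + u * (1 - Q).
have SU : S \in unitmx.
  (* The left inverse is built blockwise: [P] and [1 - P] select the two summands of [S], which are
     then sent to [Q] and [1 - Q]. *)
  suff LS : (E * B * P + (1 - Q) * invmx u * (1 - P)) *m S = 1%:M.
    by have [] := mulmx1_unit LS.
  have PS : P * S = A * Q by rewrite mulrDr !mulrA PAQ Pu addr0.
  have P'S : (1 - P) * S = u * (1 - Q) by rewrite mulrDr !mulrA P'AQ P'u add0r.
  have invu : invmx u * u = 1 := mulVmx uU.
  rewrite -[LHS]/(_ * S) mulrDl -(mulrA _ P) PS mulrA EBAQ.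
  by rewrite -(mulrA _ (1 - P)) P'S mulrA -(mulrA _ _ u) invu mulr1 Q'Q' addrC subrK.
(* Both sides reduce to [A * N ^+ s]: the [u] terms vanish since [M ^+ s] absorbs [P] and [1 - Q]
   kills [N ^+ s]. *)
have MS : M ^+ s * S = S * N ^+ s.
  rewrite /S mulrDr mulrDl !mulrA (intertwineX _ _ _ _ s MA) -!(mulrA A) NsQ cQN NsQ.
  rewrite -MsP -(mulrA _ P) -(mulrA _ (P * u)) Pu mulr0.
  by rewrite -(mulrA u) mulrBl mul1r cQN NsQ subrr mulr0.
exists (invmx S); first by rewrite unitmx_inv.
by rewrite invmxK; apply: (canRL (mulmxK SU)); exact: MS.
Qed.

Theorem theorem2p10 (R : realType) (n : nat) (A B C : 'M[R[i]]_n)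
    (hABA : A *m B *m A = A *m C *m A) (s : nat)
    (hs : (maxn (drazin_index (A *m C)) (drazin_index (B *m A)) <= s)%N) :
  mx_similar ((A *m C) ^+ s) ((B *m A) ^+ s).
Proof.
by move: hs; rewrite geq_max => /andP[hM hN]; exact: mx_similar_drazinX hABA hM hN.
Qed.
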